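(* Let $k \ge 2$ be an integer, and let $G$ be a split graph with split partition $(X, Y)$, where $|X|+|Y|$ is even. If $\beta^k(G) \ge 1$, then $G$ contains a $(k+1)$-factor.
   Context: All graphs are finite and simple. A split graph is a graph whose vertex set can be partitioned into $X$ and $Y$ with $X$ independent and $Y$ a clique; $(X,Y)$ is a split partition. For $S\subseteq V(G)$, $\Lambda^k_G(S)$ is the set of vertices with at least $k$ neighbors in $S$, and $\beta^k(G)=\min\{|\Lambda^k_G(S)|/|S| : S\subseteq V(G),\ |S|\ge k,\ \Lambda^k_G(S)\ne V(G)\}$, with $\beta^k(G)=0$ if $|V(G)|<k$. A $t$-factor is a $t$-regular spanning subgraph. *)

(* Defs.v *)
From mathcomp Require Import all_boot all_order all_algebra.

Set Implicit Arguments.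
Unset Strict Implicit.
Unset Printing Implicit Defensive.

Import Order.TTheory GRing.Theory Num.Theory.

Local Open Scope ring_scope.

Record sgraph (V : finType) := SGraph {
  adj :> rel V;
  adj_sym : symmetric adj;
  adj_irrefl : irreflexive adj
}.

Section Graph.
Variables (V : finType) (G : sgraph V).
Implicit Types (S X Y : {set V}) (u v : V) (k t : nat).

Definition nbh_in S v : {set V} := [set u in S | G v u].

Definition independent X : Prop := {in X &, forall u v, ~~ G u v}.

Definition clique Y : Prop := {in Y &, forall u v, u != v -> G u v}.

(* Either part may be empty, so the library's [partition], which forbids empty
   blocks, is not used. *)
Definition split_partition X Y : Prop :=
  [/\ X :|: Y = [set: V], [disjoint X & Y], independent X & clique Y].

Definition Lambda k S : {set V} := [set v | (k <= #|nbh_in S v|)%N].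

Definition beta_admissible k S : bool :=
  (k <= #|S|)%N && (Lambda k S != [set: V]).

Definition beta_ratio k S : rat := #|Lambda k S|%:R / #|S|%:R.

(* The [None] branch is never reached when 0 < k; see [beta_min]. *)
Definition beta k : rat :=
  if (#|V| < k)%N then 0 else
  if [pick S | beta_admissible k S
             & [forall S', beta_admissible k S' ==>
                           (beta_ratio k S <= beta_ratio k S')]] is Some A
  then beta_ratio k A else 0.

Lemma beta_admissible_ex k :
  (0 < k <= #|V|)%N -> exists S, beta_admissible k S.
Proof.
case/andP=> k0 kV.
pose S := [set x in take k (enum V)].
have cS : #|S| = k.
  rewrite /S cardsE (card_uniqP _) ?take_uniq ?enum_uniq //.
  by rewrite size_takel // -cardE.
exists S; rewrite /beta_admissible cS leqnn /=.
have /card_gt0P[x xS] : (0 < #|S|)%N by rewrite cS.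
apply/eqP => /setP/(_ x); rewrite !inE => H.
suff : (#|nbh_in S x| < #|S|)%N by rewrite cS ltnNge H.
apply/proper_card/properP; split; last by exists x => //; rewrite !inE adj_irrefl andbF.
by apply/subsetP => u; rewrite inE => /andP[].
Qed.

Lemma beta_min k : (0 < k <= #|V|)%N ->
  (exists2 S, beta_admissible k S & beta k = beta_ratio k S) /\
  (forall S, beta_admissible k S -> beta k <= beta_ratio k S).
Proof.
move=> kV; have [S0 admS0] := beta_admissible_ex kV.
rewrite /beta ltnNge (andP kV).2 /=.
case: pickP => [S /andP[admS /forallP minS]|none].
  by split=> [|S' admS']; [exists S | exact: (implyP (minS S'))].
case: (Order.TotalTheory.arg_minP (beta_ratio k) admS0) => S admS minS.
have /negP[] := negbT (none S).
by rewrite admS; apply/forallP => S'; apply/implyP/minS.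
Qed.

Definition is_factor t (H : sgraph V) : Prop :=
  subrel H G /\ forall v, #|[set u | H v u]| = t.

End Graph.

(* Main.v *)
Require Import Defs.
From mathcomp Require Import all_boot all_order all_algebra zify.

Set Implicit Arguments.
Unset Strict Implicit.
Unset Printing Implicit Defensive.

(* Let t = k + 1.  The factor is F + R, where F is a bipartite graph in which
   every x in X has degree t, and R is a graph on the clique Y that supplies the
   residual degrees t - deg_F y.  Among all F take one that minimises the sum of
   the squares of its degrees on Y; rerouting along alternating paths shows that
   such an F satisfies every uniform bound on these degrees that is compatible
   with Hall-type counting.  Applying the hypothesis on Lambda to subsets of X
   and to sets X + B with B in Y yields the Hall condition for deg_F <= t.
   Applying it to A + B with A in X and #|B| = k - 1 gives
   #|Y| >= #|X| + k - 1 and, if the excess z = #|Y| - #|X| - (k - 1) is at most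
   2, strong control on the vertices of degree 0 in F.  That is enough for the
   Erdos-Gallai condition on the residual degrees; their sum is even because
   #|X| + #|Y| is. *)

(** * Degrees, double counting, adding and deleting an edge *)

Section Graphs.
Variable V : finType.
Implicit Types (G R : sgraph V) (A B P D : {set V}) (a b u v w x y : V).

Definition deg G v := #|[set u | G v u]|.

Lemma nbh_in_sum G A v : #|nbh_in G A v| = \sum_(u in A) (G v u : nat).
Proof.
rewrite -sum1_card big_mkcond /= [RHS]big_mkcond /=.
by apply: eq_bigr => u _; rewrite inE; case: (u \in A); case: (G v u).
Qed.

Lemma deg_nbh_in G v : deg G v = #|nbh_in G setT v|.
Proof. by apply: eq_card => u; rewrite !inE. Qed.

Lemma double_count G A B :
  \sum_(a in A) #|nbh_in G B a| = \sum_(b in B) #|nbh_in G A b|.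
Proof.
under eq_bigr do rewrite nbh_in_sum.
rewrite exchange_big; apply: eq_bigr => b _; rewrite nbh_in_sum.
by apply: eq_bigr => a _; rewrite adj_sym.
Qed.

Lemma nbh_inU G A B v : [disjoint A & B] ->
  #|nbh_in G (A :|: B) v| = #|nbh_in G A v| + #|nbh_in G B v|.
Proof. by move=> dAB; rewrite !nbh_in_sum -bigU //; apply: eq_bigl => u; rewrite !inE. Qed.

Lemma nbh_in_subset G A B v : A \subset B -> #|nbh_in G A v| <= #|nbh_in G B v|.
Proof.
move=> /subsetP sAB; apply/subset_leq_card/subsetP => u.
by rewrite !inE => /andP[/sAB -> ->].
Qed.

(** Orienting each edge towards its endpoint of larger [enum_rank] counts it once. *)
Lemma handshake G : ~~ odd (\sum_v deg G v).
Proof.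
pose lt v u := enum_rank v < enum_rank u.
have -> : \sum_v deg G v = (\sum_v \sum_u (G v u && lt v u)).*2.
  rewrite -addnn [X in _ + X]exchange_big -big_split /=.
  apply: eq_bigr => v _; rewrite deg_nbh_in nbh_in_sum -big_split /=.
  rewrite big_mkcond; apply: eq_bigr => u _; rewrite inE adj_sym /lt.
  case: (ltngtP (enum_rank v) (enum_rank u)) => [||/ord_inj/enum_rank_inj ->].
  - by rewrite andbT andbF addn0.
  - by rewrite andbT andbF.
  - by rewrite adj_irrefl.
by rewrite odd_double.
Qed.

Definition is_edge a b u v := (u == a) && (v == b) || (u == b) && (v == a).

Lemma is_edge_sym a b : symmetric (is_edge a b).
Proof. by move=> u v; rewrite /is_edge orbC andbC [X in _ || X]andbC. Qed.

(** The guard [u != v] keeps the relation irreflexive even when [a = b], so [add_edge] is total. *)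
Fact add_edge_sym G a b : symmetric (fun u v => G u v || (u != v) && is_edge a b u v).
Proof. by move=> u v; rewrite adj_sym eq_sym is_edge_sym. Qed.
Fact add_edge_irrefl G a b :
  irreflexive (fun u v => G u v || (u != v) && is_edge a b u v).
Proof. by move=> u; rewrite adj_irrefl eqxx. Qed.
Definition add_edge G a b := SGraph (add_edge_sym G a b) (add_edge_irrefl G a b).

Fact del_edge_sym G a b : symmetric (fun u v => G u v && ~~ is_edge a b u v).
Proof. by move=> u v; rewrite adj_sym is_edge_sym. Qed.
Fact del_edge_irrefl G a b : irreflexive (fun u v => G u v && ~~ is_edge a b u v).
Proof. by move=> u; rewrite adj_irrefl. Qed.
Definition del_edge G a b := SGraph (del_edge_sym G a b) (del_edge_irrefl G a b).

Lemma deg_add_edge G a b v : a != b -> ~~ G a b ->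
  deg (add_edge G a b) v = deg G v + (v == a) + (v == b).
Proof.
move=> ab nab.
have [->|va] := eqVneq v a.
  rewrite (negPf ab) addn0 addn1 /deg [LHS](cardsD1 b) inE /= ab.
  rewrite /is_edge !eqxx orbT add1n; congr _.+1.
  apply: eq_card => u; rewrite !inE /= (negPf ab) /= orbF.
  by case: (eqVneq u b) => [->|] //=; rewrite ?(negPf nab) // andbF orbF.
have [->|vb] := eqVneq v b.
  rewrite addn0 addn1 /deg [LHS](cardsD1 a) inE /= eq_sym ab.
  rewrite /is_edge !eqxx !orbT add1n; congr _.+1.
  apply: eq_card => u; rewrite !inE /is_edge [b == a]eq_sym (negPf ab).
  case: (eqVneq u a) => [->|_] /=; last by rewrite !andbF orbF.
  by rewrite adj_sym (negPf nab).
rewrite !addn0; apply: eq_card => u.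
by rewrite !inE /= /is_edge (negPf va) (negPf vb) andbF orbF.
Qed.

Lemma del_edgeK G a b : G a b -> add_edge (del_edge G a b) a b =2 G.
Proof.
move=> ab u v /=; case E: (is_edge a b u v); last by rewrite andbT andbF orbF.
rewrite andbF andbT /=.
have -> : G u v by move: E => /orP[/andP[/eqP-> /eqP->]|/andP[/eqP-> /eqP->]] //; rewrite adj_sym.
case: eqVneq E => // ->; rewrite /is_edge andbC orbb => /andP[/eqP va /eqP vb].
by move: ab; rewrite -va -vb adj_irrefl.
Qed.

Lemma deg_del_edge G a b v : G a b ->
  deg G v = deg (del_edge G a b) v + (v == a) + (v == b).
Proof.
move=> ab.
have nab : a != b by apply: contraTneq ab => ->; rewrite adj_irrefl.
rewrite -deg_add_edge //; last by rewrite /= /is_edge !eqxx andbF.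
by apply: eq_card => u; rewrite !inE del_edgeK.
Qed.

End Graphs.

(* [lia] would split on every boolean that is coerced to a number. *)
Ltac abstract_lia :=
  repeat match goal with |- context [nat_of_bool ?b] =>
    generalize (nat_of_bool b); intro end; clear; lia.

(** * Sufficiency in the Erdos-Gallai theorem *)

Section ErdosGallai.
Variables (V : finType) (r : V -> nat).
Implicit Types (R : sgraph V) (P D : {set V}) (a b u v w p : V).

(** That is, [D] is a vertex cover of [R]. *)
Definition edges_meet D R := forall a b, a \notin D -> b \notin D -> ~~ R a b.

Lemma edges_meet_add D R c d : c \in D ->
  edges_meet D R -> edges_meet D (add_edge R c d).
Proof.
move=> cD mR a b aD bD /=; rewrite (negPf (mR _ _ aD bD)) /is_edge /=.
have -> : a == c = false by apply: contraNF aD => /eqP->.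
by have -> : b == c = false by [apply: contraNF bD => /eqP->]; rewrite !andbF.
Qed.

Lemma edges_meet_del D R c d : edges_meet D R -> edges_meet D (del_edge R c d).
Proof. by move=> mR a b aD bD /=; rewrite (negPf (mR _ _ aD bD)). Qed.

Lemma is_edgeF c d a b : a != c -> a != d -> @is_edge V c d a b = false.
Proof. by rewrite /is_edge => /negPf-> /negPf->. Qed.

(** Removing [p] and [v] from each other's neighbourhoods lowers both sizes equally, so the
    neighbourhood of [p] still does not fit into that of [v]. *)
Lemma private_neighbour R v p : v != p -> deg R v < deg R p ->
  exists u, [/\ R p u, ~~ R v u, u != v & u != p].
Proof.
move=> vp lt.
have : #|[set u | R v u] :\ p| < #|[set u | R p u] :\ v|.
  move: lt; rewrite /deg (cardsD1 p) (cardsD1 v [set u | R p u]) !inE.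
  by rewrite (adj_sym R p v) ltn_add2l.
move=> lt2; have /subsetPn[u] : ~~ ([set u | R p u] :\ v \subset [set u | R v u] :\ p).
  by apply: contraL lt2 => /subset_leq_card; rewrite -leqNgt.
rewrite !inE => /andP[uv pu]; rewrite negb_and negbK => Hu.
have up : u != p by apply: contraTneq pu => ->; rewrite adj_irrefl.
by exists u; split => //; move: Hu; rewrite (negPf up).
Qed.

(** An intermediate stage: [P] holds the saturated vertices, [v] is being saturated, and the others
    are still independent. *)
Definition subrealization P v R :=
  [/\ forall w, deg R w <= r w, {in P, forall p, deg R p = r p}
    & edges_meet (v |: P) R].

Hypothesis r_even : ~~ odd (\sum_v r v).
Hypothesis EG : forall D,
  \sum_(v in D) r v <= #|D| * #|D|.-1 + \sum_(v in ~: D) minn (r v) #|D|.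

(* The case analysis of Tripathi, Venugopalan and West. *)
Lemma subrealization_step P v R : v \notin P ->
  (forall p, p \in P -> r v <= r p) ->
  subrealization P v R -> deg R v < r v ->
  exists2 R', subrealization P v R' & deg R v < deg R' v.
Proof.
move=> vP rP [dR dP mR] lt.
have vD : v \in v |: P by rewrite !inE eqxx.
have PD p : p \in P -> p \in v |: P by rewrite !inE orbC => ->.
have vneq p : p \in P -> v != p by apply: contraTneq => <-.
have neP p w : p \in P -> w \notin P -> p != w by move=> pP; apply: contraNneq => <-.
(* Case 0: an unsaturated non-neighbour [w] of [v] is joined to it directly. *)
have [/existsP[w /and3P[wv nvw ltw]]|/existsPn C0] :=
  boolP [exists w, [&& w != v, ~~ R v w & deg R w < r w]].
  have vw : v != w by rewrite eq_sym.
  have dE u := deg_add_edge u vw nvw.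
  exists (add_edge R v w); last by rewrite dE eqxx; clear; lia.
  split; last exact: edges_meet_add.
    move=> u; rewrite dE; have := dR u.
    case: (eqVneq u v) => [->|_]; first by rewrite (negPf vw); move: lt; clear; lia.
    by case: (eqVneq u w) => [->|_]; move: ltw; clear; lia.
  move=> p pP; rewrite dE dP // eq_sym (negPf (vneq _ pP)).
  by have [pw|] := eqVneq p w; [move: ltw (dP _ pP); rewrite -pw; clear; lia|rewrite !addn0].
have {}C0 w : w != v -> deg R w < r w -> R v w.
  by move=> wv ltw; have := C0 w; rewrite wv ltw andbT /= negbK.
have notP w : deg R w < r w -> w \notin P by move=> ltw; apply/negP => /dP; move: ltw; clear; lia.
have nbr p : p \in P -> exists u, [/\ R p u, ~~ R v u, u != v & u != p].
  move=> pP; apply: private_neighbour; first exact: vneq.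
  by rewrite (dP p pP) (leq_trans lt) ?rP.
(* Case 1: some [p] in [P] is not adjacent to [v]. Replacing the edge [pu] by [vu] and [pv] raises
   the degree of [v] by 2 and changes no other degree. *)
have [/existsP[p /andP[pP nvp]]|/existsPn C1] := boolP [exists p, (p \in P) && ~~ R v p].
  have [u [pu nvu uv up]] := nbr p pP.
  have vu : v != u by rewrite eq_sym.
  have pv : p != v by rewrite eq_sym vneq.
  have pu' : p != u by rewrite eq_sym.
  pose R1 := add_edge R v u; pose R2 := add_edge R1 p v; pose R3 := del_edge R2 p u.
  have d1 w := deg_add_edge w vu nvu.
  have n1 : ~~ R1 p v by rewrite /= adj_sym (negPf nvp) is_edgeF ?andbF.
  have d2 w := deg_add_edge w pv n1.
  have e2 : R2 p u by rewrite /= pu.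
  have d3 w := deg_del_edge w e2.
  have m3 : edges_meet (v |: P) R3.
    by apply/edges_meet_del/edges_meet_add/edges_meet_add => //; apply: PD.
  have D3 w : deg R3 w = deg R w + (w == v).*2.
    by move: (d1 w) (d2 w) (d3 w); rewrite -/R1 -/R2 -/R3; abstract_lia.
  have [lt2|ge2] := leqP (deg R v).+2 (r v).
    exists R3; last by rewrite D3 eqxx; clear; lia.
    split => // w; rewrite D3; first by case: eqVneq => [->|_]; [move: lt2; clear; lia|rewrite addn0].
    by move=> wP; rewrite eq_sym (negPf (vneq _ wP)) addn0 dP.
  (* Here a gain of 2 exceeds [r v] by one. By parity another vertex [w] is unsaturated; by [C0] it
     is adjacent to [v], and deleting [vw] leaves a gain of 1. *)
  have [w wv ltw] : exists2 w, w != v & deg R w < r w.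
    apply/exists_inP; apply: contraR r_even; rewrite negb_exists => /forallP all_eq.
    have := handshake R; rewrite (bigD1 v) //= [\sum_w r w](bigD1 v) //=.
    rewrite (eq_bigr (fun w => r w)) => [|w wv].
      by have -> : r v = (deg R v).+1 by [move: lt ge2; clear; lia]; rewrite addSn /= => ->.
    by have := all_eq w; have := dR w; rewrite wv /=; clear; lia.
  have vw := C0 _ wv ltw.
  have wP := notP _ ltw.
  have wu : w != u by apply: contraTneq vw => ->.
  have wp : w != p by rewrite eq_sym neP.
  pose R4 := del_edge R3 v w.
  have e4 : R3 v w by rewrite /= vw /= is_edge_sym is_edgeF.
  have d4 x := deg_del_edge x e4.
  exists R4; last by move: (d4 v) (D3 v); rewrite -/R4 eqxx (eq_sym v w) (negPf wv); clear; lia.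
  split; last exact: edges_meet_del.
    move=> x; move: (d4 x) (D3 x) (dR x); rewrite -/R4.
    by case: (eqVneq x v) => [->|_]; move: lt; clear; lia.
  move=> x xP; move: (d4 x) (D3 x) (dP x xP); rewrite -/R4.
  by rewrite (negPf (neP _ _ xP vP)) (negPf (neP _ _ xP wP)); clear; lia.
have {}C1 p : p \in P -> R v p by move=> pP; have := C1 p; rewrite pP negbK.
have uP u : ~~ R v u -> u \notin P by apply: contra => /C1.
have cD : #|v |: P| = #|P|.+1 by rewrite cardsU1 vP.
have subN w : w \notin v |: P -> [set u | R w u] \subset v |: P.
  move=> wD; apply/subsetP => u; rewrite inE => wu.
  by apply: contraTT wu => uD; apply: mR.
(* Case 2: some [w] outside [v |: P] could still gain a neighbour there. It misses some [p] in [P],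
   and [pu] is replaced by [vu] and [pw]. *)
have [/existsP[w /andP[wD nw]]|/existsPn C2] :=
  boolP [exists w, (w \notin v |: P) && (deg R w != minn (r w) #|P|.+1)].
  have dw : deg R w <= #|P|.+1 by rewrite -cD; apply/subset_leq_card/subN.
  have [ltw ltw2] : deg R w < r w /\ deg R w < #|P|.+1 by move: (dR w) dw nw; clear; lia.
  have wv : w != v by apply: contraNneq wD => ->.
  have wP : w \notin P by apply: notP.
  have vw := C0 _ wv ltw.
  have /subsetPn[p pD npw] : ~~ (v |: P \subset [set u | R w u]).
    by apply: contraL ltw2 => /subset_leq_card; rewrite cD -leqNgt.
  have pP : p \in P.
    by move: pD npw; rewrite !inE => /orP[/eqP->|//]; rewrite adj_sym vw.
  have nwp : ~~ R p w by move: npw; rewrite inE adj_sym.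
  have [u [pu nvu uv up]] := nbr p pP.
  have uw : u != w by apply: contraNneq nvu => ->.
  have vu : v != u by rewrite eq_sym.
  have pw := neP _ _ pP wP.
  pose R1 := add_edge R v u; pose R2 := add_edge R1 p w; pose R3 := del_edge R2 p u.
  have d1 x := deg_add_edge x vu nvu.
  have n1 : ~~ R1 p w by rewrite /= (negPf nwp) is_edgeF ?andbF // eq_sym ?vneq.
  have d2 x := deg_add_edge x pw n1.
  have e2 : R2 p u by rewrite /= pu.
  have d3 x := deg_del_edge x e2.
  have D3 x : deg R3 x = deg R x + (x == v) + (x == w).
    by move: (d1 x) (d2 x) (d3 x); rewrite -/R1 -/R2 -/R3; abstract_lia.
  exists R3; last by rewrite D3 eqxx; clear; lia.
  split; last by apply/edges_meet_del/edges_meet_add/edges_meet_add => //; apply: PD.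
    move=> x; rewrite D3; move: (dR x).
    case: (eqVneq x v) => [->|_]; first by rewrite eq_sym (negPf wv); move: lt; clear; lia.
    by case: (eqVneq x w) => [->|_]; move: ltw; clear; lia.
  by move=> x xP; rewrite D3 (negPf (neP _ _ xP vP)) (negPf (neP _ _ xP wP)) !addn0 dP.
have {}C2 w : w \notin v |: P -> deg R w = minn (r w) #|P|.+1.
  by move=> wD; have := C2 w; rewrite wD negbK => /eqP.
(* Case 3: [p] and [q] in [P] are not adjacent. Adding [vu] and [pq] and deleting [pu] and [qt]
   lowers only the degree of [t], which is outside [P] and may equal [u]. *)
have [/exists_inP[p pP /exists_inP[q qP /andP[pq npq]]]|] :=
  boolP [exists p in P, exists q in P, (p != q) && ~~ R p q].
  have [u [pu nvu uv up]] := nbr p pP.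
  have [t [qt nvt tv tq]] := nbr q qP.
  have vu : v != u by rewrite eq_sym.
  have qu : q != u by apply: contraNneq nvu => <-; apply: C1.
  pose R1 := add_edge R v u; pose R2 := add_edge R1 p q.
  pose R3 := del_edge R2 p u; pose R4 := del_edge R3 q t.
  have d1 x := deg_add_edge x vu nvu.
  have n1 : ~~ R1 p q.
    by rewrite /= (negPf npq) is_edgeF ?andbF // eq_sym ?vneq.
  have d2 x := deg_add_edge x pq n1.
  have e2 : R2 p u by rewrite /= pu.
  have d3 x := deg_del_edge x e2.
  have e3 : R3 q t by rewrite /= qt /= is_edgeF // eq_sym.
  have d4 x := deg_del_edge x e3.
  have D4 x : deg R4 x + (x == t) = deg R x + (x == v).
    by move: (d1 x) (d2 x) (d3 x) (d4 x); rewrite -/R1 -/R2 -/R3 -/R4; abstract_lia.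
  exists R4; last by move: (D4 v); rewrite eqxx (eq_sym v t) (negPf tv); clear; lia.
  split; last by do 2!apply/edges_meet_del; apply/edges_meet_add/edges_meet_add => //; apply: PD.
    by move=> x; move: (D4 x) (dR x); case: (eqVneq x v) => [->|_]; move: lt; clear; lia.
  move=> x xP; move: (D4 x); rewrite (negPf (neP _ _ xP vP)).
  by rewrite (negPf (neP _ _ xP (uP _ nvt))) !addn0 dP.
move=> /exists_inPn C3.
have clD : {in v |: P &, forall a b, a != b -> R a b}.
  move=> a b; rewrite !inE => /orP[/eqP->|aP] /orP[/eqP->|bP]; rewrite ?eqxx // => ab.
  - exact: C1.
  - by rewrite adj_sym C1.
  - by have /exists_inPn/(_ b bP) := C3 a aP; rewrite ab negbK.
(* Now [v |: P] is a clique and every outside vertex has its largest possible degree into it. So its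
   degree sum reaches the right side of [EG], yet it is below the sum of [r] because [v] is
   unsaturated. *)
have := EG (v |: P); set D := v |: P in cD mR clD subN C2 vD PD *; clearbody D.
have -> : \sum_(w in ~: D) minn (r w) #|D| = \sum_(w in ~: D) #|nbh_in R D w|.
  apply: eq_bigr => w; rewrite inE => wD; rewrite cD -C2 //; apply: eq_card => u.
  by rewrite !inE; case wu: (R w u); rewrite ?andbF // (subsetP (subN _ wD)) // inE.
rewrite -double_count -sum_nat_const -big_split /= => le.
suff : \sum_(w in D) deg R w < \sum_(w in D) r w.
  rewrite ltnNge => /negP[]; apply: leq_trans le _; apply: leq_sum => w wD.
  have dC : [disjoint D & ~: D] by rewrite disjoints_subset setCK.
  rewrite deg_nbh_in -(setUCr D) nbh_inU // leq_add2r (cardsD1 w D) wD /=.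
  apply/subset_leq_card/subsetP => u; rewrite !inE => /andP[uw uD].
  by rewrite uD clD // eq_sym.
rewrite (bigD1 v) // [X in _ < X](bigD1 v) //= -addSn leq_add //.
by apply: leq_sum => w _.
Qed.

Lemma subrealization_saturate P v R : v \notin P ->
  (forall p, p \in P -> r v <= r p) ->
  subrealization P v R -> exists2 R', subrealization P v R' & deg R' v = r v.
Proof.
move=> vP rP; have [n] := ubnP (r v - deg R v); elim: n R => // n IH R le sR.
have [dR _ _] := sR; have := dR v; rewrite leq_eqVlt => /orP[/eqP?|lt].
  by exists R.
have [R' sR' lt'] := subrealization_step vP rP sR lt.
by apply: IH sR'; move: le lt lt'; clear; lia.
Qed.

Fact empty_sym : symmetric (fun _ _ : V => false). Proof. by []. Qed.
Fact empty_irrefl : irreflexive (fun _ _ : V => false). Proof. by []. Qed.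

(** Starting from the edgeless graph, the vertices are saturated one at a time in order of
    decreasing [r]. *)
Lemma erdos_gallai : exists R : sgraph V, forall v, deg R v = r v.
Proof.
have H n : n <= #|V| -> exists P R, [/\ #|P| = n,
    forall p q, p \in P -> q \notin P -> r q <= r p,
    forall w, deg R w <= r w, {in P, forall p, deg R p = r p} & edges_meet P R].
  elim: n => [_|n IH lt].
    exists set0, (SGraph empty_sym empty_irrefl).
    split => [|p q|w|p|//]; rewrite ?cards0 ?inE //.
    by rewrite /deg (@eq_card0 _ _) // => u; rewrite !inE.
  have [P [R [cP rP dR dP mR]]] := IH (ltnW lt).
  have [v0 v0P] : exists v, v \notin P.
    apply/existsP; apply: contraTT lt; rewrite negb_exists => /forallP allP.
    by rewrite -leqNgt -cP; apply/subset_leq_card/subsetP => v _; have := allP v; rewrite negbK.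
  have [v vP vmax] := @arg_maxnP _ v0 (fun v => v \notin P) r v0P.
  have [R' [dR' dP' mR'] dv] : exists2 R', subrealization P v R' & deg R' v = r v.
    apply: (@subrealization_saturate P v R) => // [p pP|]; first exact: rP.
    by split=> // a b; rewrite !inE !negb_or => /andP[_ aP] /andP[_ bP]; apply: mR.
  exists (v |: P), R'; split => //.
  - by rewrite cardsU1 vP cP.
  - move=> p q; rewrite !inE => /orP[/eqP->|pP]; rewrite negb_or => /andP[qv qP].
      exact: vmax.
    exact: rP.
  - by move=> p; rewrite !inE => /orP[/eqP->|/dP'].
have [P [R [cP _ _ dP _]]] := H _ (leqnn _).
have PT : P = setT by apply/eqP; rewrite eqEcard subsetT cardsT cP leqnn.
by exists R => v; apply: dP; rewrite PT inE.
Qed.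

End ErdosGallai.

(** * Selections of minimal cost and alternating paths *)

Lemma sub_path_mem (T : eqType) (e e' : rel T) y p :
  (forall a b, a \in y :: p -> b \in p -> e a b -> e' a b) -> path e y p -> path e' y p.
Proof.
elim: p y => //= z p IH y sub /andP[yz pth].
rewrite sub ?mem_head //=; apply: IH pth => a b ap bp; apply: sub.
  by rewrite inE ap orbT.
by rewrite inE bp orbT.
Qed.

Section Balanced.
Variables (V : finType) (G : sgraph V) (X : {set V}) (t : nat).
Implicit Types (F : {ffun V -> {set V}}) (U Z B : {set V}) (u v w x y : V).

(* Each [x] in [X] selects [t] of its neighbours, namely [F x]. *)
Definition selection F :=
  [forall x in X, (F x \subset [set u | G x u]) && (#|F x| == t)].

(** The degree deg_F y in the bipartite graph given by [F]. *)
Definition load F y := #|[set x in X | y \in F x]|.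

Definition cost F := \sum_y load F y ^ 2.

Definition balanced F := selection F /\ forall F', selection F' -> cost F <= cost F'.

Lemma selectionP F : reflect
  (forall x, x \in X -> F x \subset [set u | G x u] /\ #|F x| = t) (selection F).
Proof.
apply: (iffP forall_inP) => H x /H; first by case/andP => ? /eqP.
by case=> -> ->; rewrite eqxx.
Qed.

Lemma sum_load F Z : \sum_(y in Z) load F y = \sum_(x in X) #|F x :&: Z|.
Proof.
have E A (p : pred V) : #|[set v in A | p v]| = \sum_(v in A) (p v : nat).
  rewrite -sum1_card big_mkcond /= [RHS]big_mkcond /=.
  by apply: eq_bigr => v _; rewrite inE; case: (v \in A); case: (p v).
under eq_bigr do rewrite /load E.
rewrite exchange_big; apply: eq_bigr => x _; rewrite -E.
by apply: eq_card => y; rewrite !inE andbC.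
Qed.

Lemma ex_balanced : (forall x, x \in X -> t <= deg G x) -> exists F, balanced F.
Proof.
move=> degX.
pose F0 : {ffun V -> {set V}} := [ffun x => [set u in take t (enum [set u | G x u])]].
have sF0 : selection F0.
  apply/selectionP => x /degX le; rewrite ffunE; split.
    by apply/subsetP => u; rewrite !inE => /mem_take; rewrite mem_enum inE.
  rewrite cardsE (card_uniqP _) ?take_uniq ?enum_uniq // size_takel //.
  by rewrite -cardE.
by have [F sF minF] := arg_minnP cost sF0; exists F.
Qed.

(** An arc from [y'] to [y] means that some [x] may exchange [y] for [y']; rerouting moves a unit of
    load against the arc. *)
Definition step F : rel V :=
  fun y' y => [exists x in X, [&& G x y', y' \notin F x & y \in F x]].

Definition reroute F x y' y : {ffun V -> {set V}} :=
  [ffun w => if w == x then y' |: (F x :\ y) else F w].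

Lemma reroute_selection F x y' y : selection F -> G x y' -> y' \notin F x ->
  y \in F x -> selection (reroute F x y' y).
Proof.
move=> /selectionP sF xy' ny' Fy; apply/selectionP => w wX; rewrite ffunE.
case: eqVneq => [wx|_]; last exact: sF.
subst w; have [sub cF] := sF _ wX; split.
  apply/subsetP => u; rewrite !inE => /orP[/eqP->//|/andP[_ /(subsetP sub)]].
  by rewrite inE.
by rewrite cardsU1 !inE (negPf ny') andbF -cF (cardsD1 y (F x)) Fy.
Qed.

Lemma load_reroute F x y' y w : x \in X -> y' \notin F x -> y \in F x ->
  load (reroute F x y' y) w + (w == y) = load F w + (w == y').
Proof.
move=> xX ny' Fy; have yy' : y != y' by apply: contraNneq ny' => <-.
rewrite /load (cardsD1 x) (cardsD1 x [set z in X | w \in F z]) !inE xX /= ffunE eqxx.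
rewrite !inE; have -> : [set z in X | w \in reroute F x y' y z] :\ x
                      = [set z in X | w \in F z] :\ x.
  by apply/setP => z; rewrite !inE ffunE; case: eqVneq.
case: (eqVneq w y) => [->|_]; first by rewrite (negPf yy') Fy; lia.
by case: (eqVneq w y') => [->|_] /=; rewrite ?(negPf ny'); lia.
Qed.

Lemma cost_reroute F x y' y : x \in X -> y' \notin F x -> y \in F x ->
  cost (reroute F x y' y) + (load F y).*2 = cost F + (load F y').*2 + 2.
Proof.
move=> xX ny' Fy; have yy' : y' != y by apply: contraNneq ny' => ->.
have E w := load_reroute w xX ny' Fy.
rewrite /cost (bigD1 y) //= [in RHS](bigD1 y) //=.
rewrite (bigD1 y') //= [in RHS](bigD1 y') //=.
rewrite [in LHS](eq_bigr (fun w => load F w ^ 2)) => [|w /andP[wy wy']].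
  move: (E y) (E y'); rewrite !eqxx (negPf yy') eq_sym (negPf yy').
  by set s := \sum_(i | _) _; set a := load F y; set b := load F y';
     set a' := load _ y; set b' := load _ y' => ? ?; clearbody a b a' b' s; nia.
by move: (E w); rewrite (negPf wy) (negPf wy') !addn0 => ->.
Qed.

(** The exchange changes the cost by twice [load F y' + 1 - load F y], which minimality makes
    nonnegative. *)
Lemma balanced_step F y' y : balanced F -> step F y' y -> load F y <= (load F y').+1.
Proof.
move=> [sF minF] /exists_inP[x xX /and3P[xy' ny' Fy]].
have := minF _ (reroute_selection sF xy' ny' Fy).
by have := cost_reroute xX ny' Fy; lia.
Qed.

(* When the first step of the path goes up, rerouting along it keeps the cost
   minimal and, the path being simple, leaves its other steps available. *)
Lemma balanced_path F y p : balanced F -> path (step F) y p -> uniq (y :: p) ->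
  load F (last y p) <= (load F y).+1.
Proof.
elim: p F y => [|y1 p IH] F y bF //= /andP[st pth] /andP[yp u1].
have le1 := balanced_step bF st; have le2 := IH F y1 bF pth u1.
have [le3|lt3] := leqP (load F y1) (load F y); first lia.
have E : load F y1 = (load F y).+1 by lia.
move: st => /exists_inP[x xX /and3P[xy ny Fy1]].
have [sF minF] := bF.
pose F' := reroute F x y y1.
have ld w := load_reroute w xX ny Fy1.
have bF' : balanced F'.
  split; first exact: reroute_selection.
  by have := cost_reroute xX ny Fy1 => cE F2 /minF; rewrite -/F' in cE; lia.
have yy1 : y != y1 by move: yp; rewrite inE negb_or => /andP[].
have pth' : path (step F') y1 p.
  move: u1 => /= /andP[y1p _]; apply: sub_path_mem pth => a b ap bp.
  have ay : a != y by apply: contraNneq yp => <-.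
  have by1 : b != y1 by apply: contraNneq y1p => <-.
  move=> /exists_inP[z zX /and3P[za na Fb]].
  apply/exists_inP; exists z => //; rewrite za ffunE; case: eqVneq => [zx|_].
    by rewrite !inE -zx (negPf ay) (negPf na) by1 Fb andbF orbT.
  by rewrite na Fb.
have [p0|pn0] := eqVneq p [::]; first by rewrite p0.
have lp : last y1 p \in p by case: (p) pn0 => //= z q _; apply: mem_last.
(* In [F'] the loads of [y] and [y1] are swapped, so induction from [y1] gives the wanted bound; the
   last vertex is neither of them and keeps its load. *)
have := IH F' y1 bF' pth' u1; move: (ld (last y1 p)) (ld y1); rewrite -/F' eqxx.
have -> : last y1 p == y1 = false.
  by move: u1 => /= /andP[y1p _]; apply: contraNF y1p => /eqP<-.
have -> : last y1 p == y = false.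
  by apply: contraNF yp => /eqP<-; rewrite inE lp orbT.
by rewrite eq_sym (negPf yy1); lia.
Qed.

Definition reach F U := [set y | [exists y0 in U, connect (step F) y0 y]].

Definition step_closed F Z := forall y' y, y' \in Z -> step F y' y -> y \in Z.

Lemma sub_reach F U : U \subset reach F U.
Proof. by apply/subsetP => y yU; rewrite inE; apply/exists_inP; exists y. Qed.

Lemma reach_closed F U : step_closed F (reach F U).
Proof.
move=> y' y; rewrite !inE => /exists_inP[y0 y0U c0] st; apply/exists_inP.
by exists y0 => //; apply: connect_trans c0 (connect1 st).
Qed.

Lemma balanced_connect F y' y : balanced F -> connect (step F) y' y ->
  load F y <= (load F y').+1.
Proof.
move=> bF /connectP[p pth ->]; have [q pthq uq _] := shortenP pth.
exact: balanced_path.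
Qed.

Lemma balanced_reach F U m y : balanced F -> (forall y0, y0 \in U -> load F y0 <= m) ->
  y \in reach F U -> load F y <= m.+1.
Proof.
move=> bF leU; rewrite inE => /exists_inP[y0 y0U c0].
by apply: leq_trans (balanced_connect bF c0) _; rewrite ltnS leU.
Qed.

(** If [x] leaves out a neighbour [y'] in [Z], all of [F x] is one step away from [y'], hence in
    [Z]; otherwise [F x] contains every neighbour of [x] in [Z]. *)
Lemma card_closed F Z x : selection F -> step_closed F Z -> x \in X ->
  #|F x :&: Z| = minn t #|nbh_in G Z x|.
Proof.
move=> /selectionP sF cZ xX; have [/subsetP sub cF] := sF x xX.
have sub1 : F x :&: Z \subset nbh_in G Z x.
  by apply/subsetP => y; rewrite !inE => /andP[/sub]; rewrite inE => -> ->.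
have [sub2|/subsetPn[y' ]] := boolP (nbh_in G Z x \subset F x).
  have -> : F x :&: Z = nbh_in G Z x.
    apply/eqP; rewrite eqEsubset sub1 subsetI sub2 /=.
    by apply/subsetP => y; rewrite inE => /andP[].
  by apply/esym/minn_idPr; rewrite -cF subset_leq_card.
rewrite inE => /andP[y'Z xy'] ny'.
have /setIidPl FZ : F x \subset Z.
  apply/subsetP => y Fy; apply: cZ y'Z _.
  by apply/exists_inP; exists x => //; rewrite xy' ny'.
rewrite FZ cF; apply/esym/minn_idPl.
by rewrite -cF -FZ subset_leq_card.
Qed.

Lemma sum_load_closed F Z : selection F -> step_closed F Z ->
  \sum_(y in Z) load F y = \sum_(x in X) minn t #|nbh_in G Z x|.
Proof. by move=> sF cZ; rewrite sum_load; apply: eq_bigr => x; apply: card_closed. Qed.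

(** If [load F y > m], all loads on the set [Z] from which [y] can be reached are at least [m]. The
    complement of [Z] is closed, so each [x] selects from [Z] only what it cannot select outside;
    thus the load on [Z] violates the Hall-type bound. *)
Lemma balanced_upper F m y : balanced F ->
  (forall B, \sum_(x in X) (t - #|nbh_in G B x|) <= m * #|~: B|) -> load F y <= m.
Proof.
move=> bF hall; have sF := bF.1; rewrite leqNgt; apply/negP => gt.
pose Z := [set w | connect (step F) w y].
have cZ : step_closed F (~: Z).
  move=> a b; rewrite !inE => na st; apply: contra na; exact: connect_trans (connect1 st).
have : \sum_(w in Z) load F w <= m * #|Z|.
  have := hall (~: Z); rewrite setCK; apply: leq_trans.
  rewrite sum_load leq_eqVlt; apply/orP; left; apply/eqP/eq_bigr => x xX.
  have := card_closed sF cZ xX; have [_ cF] := selectionP _ sF x xX.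
  by have := cardsID Z (F x); rewrite setDE; lia.
apply/negP; rewrite -ltnNge mulnC -sum_nat_const.
have yZ : y \in Z by rewrite inE.
rewrite (bigD1 y) // [X in _ < X](bigD1 y) //= -addSn leq_add //.
apply: leq_sum => w /andP[]; rewrite inE => cw _.
by have := balanced_connect bF cw; lia.
Qed.

End Balanced.

(** * Consequences of the hypothesis on [Lambda] in a split graph *)

Lemma ex_subset_card (T : finType) (A : {set T}) m :
  m <= #|A| -> exists2 B : {set T}, B \subset A & #|B| = m.
Proof.
move=> le; exists [set x in take m (enum A)].
  by apply/subsetP => x; rewrite inE => /mem_take; rewrite mem_enum.
by rewrite cardsE (card_uniqP _) ?take_uniq ?enum_uniq // size_takel // -cardE.
Qed.

Section Split.
Variables (V : finType) (G : sgraph V) (X Y : {set V}) (k : nat).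
Hypothesis k_gt1 : 1 < k.
Hypothesis XY_split : split_partition G X Y.
Hypothesis k_leV : k <= #|V|.
Hypothesis Lambda_ge : forall S : {set V}, k <= #|S| -> #|S| <= #|Lambda G k S|.
Implicit Types (A B C T Z : {set V}) (u v w x y : V).

Local Notation e x B := #|nbh_in G B x|.

Lemma in_Y v : (v \in Y) = (v \notin X).
Proof.
have [cov dis _ _] := XY_split; have : v \in X :|: Y by rewrite cov inE.
rewrite inE; case: (boolP (v \in X)) => [vX _|//].
by rewrite (disjointFr dis vX).
Qed.

Lemma disjoint_split A B : A \subset X -> B \subset Y -> [disjoint A & B].
Proof.
have [_ dis _ _] := XY_split => AX BY.
exact: disjointWl AX (disjointWr BY dis).
Qed.

Lemma adj_X_Y x u : x \in X -> G x u -> u \in Y.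
Proof.
have [_ _ ind _] := XY_split => xX; apply: contraTT; rewrite in_Y negbK => uX.
exact: ind.
Qed.

Lemma nbh_in_X x A : x \in X -> A \subset X -> e x A = 0.
Proof.
move=> xX /subsetP AX; apply: eq_card0 => u; rewrite inE; apply/negP => /andP[/AX uX xu].
by have := adj_X_Y xX xu; rewrite in_Y uX.
Qed.

Lemma nbh_in_Y y B : y \in Y -> B \subset Y -> e y B = #|B| - (y \in B).
Proof.
have [_ _ _ cl] := XY_split => yY /subsetP BY.
have -> : e y B = #|B :\ y|.
  apply: eq_card => u; rewrite !inE; have [->|uy] := eqVneq u y.
    by rewrite adj_irrefl andbF.
  case uB: (u \in B) => //=; apply: cl => //; [exact: BY|by rewrite eq_sym].
by rewrite (cardsD1 y B) addKn.
Qed.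

Lemma deg_X x : x \in X -> deg G x = e x Y.
Proof.
move=> xX; apply: eq_card => u; rewrite !inE; case xu: (G x u); rewrite ?andbF //.
by rewrite (adj_X_Y xX xu).
Qed.

(** If [S] is a [k]-set containing [x], every vertex of [Lambda G k S] is adjacent to all of [S]. *)
Lemma k_le_deg x : k <= deg G x.
Proof.
have [B sB cB] : exists2 B : {set V}, B \subset [set~ x] & #|B| = k.-1.
  by apply: ex_subset_card; rewrite cardsC1; lia.
have xB : x \notin B by apply/negP => /(subsetP sB); rewrite !inE eqxx.
have cS : #|x |: B| = k by rewrite cardsU1 xB cB; lia.
rewrite -{1}cS; apply: leq_trans (Lambda_ge _) _; first by rewrite cS.
apply/subset_leq_card/subsetP => v; rewrite !inE adj_sym -{1}cS => le.
have : x \in nbh_in G (x |: B) v.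
  suff /eqP -> : nbh_in G (x |: B) v == x |: B by rewrite !inE eqxx.
  by rewrite eqEcard le andbT; apply/subsetP => u; rewrite inE => /andP[].
by rewrite inE => /andP[].
Qed.

(** In [A :|: B] a vertex of [X] has at most [k - 1] neighbours, all in [B]. A vertex of [Y] has
    [k - 1] neighbours in [B], or [k - 2] if it lies in [B], and needs the rest in [A]. *)
Lemma neighbourhood_growth A B : A \subset X -> A != set0 -> B \subset Y ->
  #|B| = k.-1 -> #|A| + k.-1 <= #|[set y in Y | (y \in B) < e y A]|.
Proof.
move=> AX A0 BY cB; have dAB := disjoint_split AX BY.
have cS : #|A :|: B| = #|A| + k.-1.
  by rewrite -cB cardsU; move: dAB; rewrite -setI_eq0 => /eqP->; rewrite cards0 subn0.
rewrite -cS; apply: leq_trans (Lambda_ge _) _.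
  by rewrite cS; move: A0; rewrite -card_gt0; lia.
apply/subset_leq_card/subsetP => v; rewrite !inE nbh_inU //.
case vX: (v \in X).
  rewrite nbh_in_X // => le; have : e v B <= #|B|.
    by apply/subset_leq_card/subsetP => u; rewrite inE => /andP[].
  by lia.
have vY : v \in Y by rewrite in_Y vX.
rewrite vY /= (nbh_in_Y vY BY) cB; lia.
Qed.

(** Take [A = {x}] and [B] a set of [k - 1] neighbours of [x]. A member of [B] would need two
    neighbours in [A], so at least [k] neighbours of [x] lie outside [B]. *)
Lemma deg_X_ge x : x \in X -> k.*2.-1 <= e x Y.
Proof.
move=> xX; have kd := k_le_deg x; rewrite deg_X // in kd.
have [B sB cB] : exists2 B : {set V}, B \subset nbh_in G Y x & #|B| = k.-1.
  by apply: ex_subset_card; lia.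
have BY : B \subset Y.
  by apply: subset_trans sB _; apply/subsetP => u; rewrite inE => /andP[].
have := @neighbourhood_growth [set x] B; rewrite sub1set xX cards1 -card_gt0 cards1.
move=> /(_ isT isT BY cB) le.
have : #|[set y in Y | (y \in B) < e y [set x]]| <= #|nbh_in G Y x :\: B|.
  apply/subset_leq_card/subsetP => y; rewrite !inE => /andP[-> lt].
  have lt1 : 0 < e y [set x] by apply: leq_ltn_trans lt.
  have /card_gt0P[u] := lt1; rewrite !inE => /andP[/eqP-> yx].
  have le1 : e y [set x] <= 1.
    rewrite -(cards1 x); apply/subset_leq_card/subsetP => w.
    by rewrite !inE => /andP[].
  by rewrite adj_sym yx; move: lt; case: (y \in B) => //; rewrite ltnNge le1.
have := cardsID B (nbh_in G Y x); rewrite (setIidPr sB) cB; lia.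
Qed.

Lemma card_Y_ge : #|X| + k.-1 <= #|Y|.
Proof.
have [X0|X0] := eqVneq X set0.
  have -> : Y = setT by apply/setP => v; rewrite in_Y X0 !inE.
  by rewrite X0 cards0 cardsT; lia.
have [x xX] := set0Pn _ X0.
have [B sB cB] : exists2 B : {set V}, B \subset Y & #|B| = k.-1.
  apply: ex_subset_card; have := deg_X_ge xX.
  have : e x Y <= #|Y| by apply/subset_leq_card/subsetP => u; rewrite inE => /andP[].
  by lia.
apply: leq_trans (neighbourhood_growth (subxx X) X0 sB cB) _.
by apply/subset_leq_card/subsetP => u; rewrite inE => /andP[].
Qed.

(** Now [G] is complete, and a vertex with [k] neighbours in a [k]-set lies outside it. *)
Lemma card_Y_ge_X0 : X = set0 -> k.*2 <= #|Y|.
Proof.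
move=> X0; have YT : Y = setT by apply/setP => v; rewrite in_Y X0 !inE.
have [S _ cS] : exists2 S : {set V}, S \subset setT & #|S| = k.
  by apply: ex_subset_card; rewrite cardsT.
have le : k <= #|~: S|.
  rewrite -{1}cS; apply: leq_trans (Lambda_ge _) _; first by rewrite cS.
  apply/subset_leq_card/subsetP => v; rewrite !inE nbh_in_Y ?YT ?subsetT ?inE // cS.
  by case: (v \in S) => //; lia.
by have := cardsC S; rewrite YT cardsT cS; lia.
Qed.

(** The hypothesis is applied to [X :|: B], of which a vertex of [X] sees only [B]; all of [Y] may
    lie in [Lambda]. *)
Lemma few_X_with_few_nbh B : B \subset Y ->
  #|[set x in X | e x B < k]| <= #|Y :\: B|.
Proof.
move=> BY; have dXB := disjoint_split (subxx X) BY.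
have cS : #|X :|: B| = #|X| + #|B|.
  by rewrite cardsU; move: dXB; rewrite -setI_eq0 => /eqP->; rewrite cards0 subn0.
have leX : #|[set x in X | e x B < k]| <= #|X|.
  by apply/subset_leq_card/subsetP => u; rewrite inE => /andP[].
have cYB := cardsID B Y; rewrite (setIidPr BY) in cYB.
(* If [X :|: B] is too small for the hypothesis, the degree bound [2k - 1] makes [Y :\: B] large
   enough. *)
have [kS|Sk] := leqP k #|X :|: B|; last first.
  have [X0|X0] := eqVneq X set0; first by move: leX; rewrite {2}X0 cards0; lia.
  have [x xX] := set0Pn _ X0; have := deg_X_ge xX.
  have : e x Y <= #|Y| by apply/subset_leq_card/subsetP => u; rewrite inE => /andP[].
  by rewrite cS in Sk; lia.
have := Lambda_ge kS; rewrite cS.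
have : #|Lambda G k (X :|: B)| <= #|Y :|: [set x in X | k <= e x B]|.
  apply/subset_leq_card/subsetP => v; rewrite !inE nbh_inU // in_Y.
  by case vX: (v \in X) => //=; rewrite nbh_in_X.
have := leq_of_leqif (leq_card_setU Y [set x in X | k <= e x B]).
have : #|[set x in X | e x B < k]| + #|[set x in X | k <= e x B]| = #|X|.
  rewrite -(cardsID [set x | e x B < k] X); congr (_ + _); apply: eq_card => u.
    by rewrite !inE.
  by rewrite !inE -leqNgt andbC.
by lia.
Qed.

(* Let [A] be the set of [x] with at most [k] neighbours in [B].  A maximal
   [T] in [A] in which no new vertex of [B] has [k] neighbours is small, by the
   hypothesis applied to [T]; its saturated vertices [R0] then hit the rest of
   [A], and the hypothesis applied to [X :|: (B :\: R)] bounds [A]. *)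
Lemma hall_condition B : B \subset Y ->
  \sum_(x in X) (k.+1 - e x B) <= k.+1 * #|Y :\: B|.
Proof.
move=> BY; set C := Y :\: B.
pose Al := [set x in X | e x B < k]; pose Ak := [set x in X | e x B == k].
pose W := [set y in B | k <= e y Al].
pose good (T : {set V}) :=
  (T \subset Ak) && [forall y in B :\: W, e y (Al :|: T) < k].
have AlX : Al \subset X by apply/subsetP => x; rewrite inE => /andP[].
have AkX : Ak \subset X by apply/subsetP => x; rewrite inE => /andP[].
have good0 : good set0.
  rewrite /good sub0set; apply/forall_inP => y; rewrite !inE setU0 => /andP[nW yB].
  by move: nW; rewrite yB /= -ltnNge.
have [T' /maxsetP[/andP[T'k /forall_inP T'W] T'max] _] := maxset_exists good0.
(* Vertices of [R0] are one neighbour short of [k], and [Tu] is the part of [T'] that [R0] misses.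
   Adding a neighbour [f x] for each [x] in [Tu] makes [R] meet the neighbourhood of every vertex of
   [Ak]. *)
pose T := Al :|: T'; pose R0 := [set y in B :\: W | e y T == k.-1].
pose Tu := [set x in T' | e x R0 == 0].
pose f x := odflt x [pick u in nbh_in G B x].
pose R := R0 :|: f @: Tu.
have TX : T \subset X by rewrite subUset AlX (subset_trans T'k).
have dAlk : [disjoint Al & Ak].
  rewrite -setI_eq0; apply/eqP/setP => x; rewrite !inE.
  by apply/negP => /andP[/andP[_ lt] /andP[_ /eqP eq]]; rewrite eq ltnn in lt.
have dT : [disjoint Al & T'] by apply: disjointWr dAlk.
have cT : #|T| = #|Al| + #|T'|.
  by rewrite cardsU; move: dT; rewrite -setI_eq0 => /eqP->; rewrite cards0 subn0.
have R0B : R0 \subset B by apply/subsetP => y; rewrite !inE => /andP[/andP[]].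
have fB x : x \in Ak -> f x \in nbh_in G B x.
  rewrite inE => /andP[_ /eqP ex]; rewrite /f; case: pickP => //= none.
  by have := eq_card0 none; rewrite ex; move: k_gt1; clear; lia.
have RB : R \subset B.
  rewrite subUset R0B; apply/subsetP => _ /imsetP[x + ->]; rewrite inE => /andP[xT' _].
  by have := fB x (subsetP T'k _ xT'); rewrite inE => /andP[].
(* [Lambda G k T] lies in [C :|: W]. If [T] is nonempty with fewer than [k] elements, the degree
   bound [2k - 1] gives [#|C| >= k - 1] instead. *)
have le1 : #|Al| + #|T'| <= #|C| + #|W|.
  rewrite -cT; have [kT|Tk] := leqP k #|T|.
    apply: leq_trans (Lambda_ge kT) _.
    apply: leq_trans (leq_of_leqif (leq_card_setU C W)).
    apply/subset_leq_card/subsetP => v; rewrite inE => kv.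
    have vY : v \in Y.
      by rewrite in_Y; apply: contraTN kv => vX; rewrite nbh_in_X // -ltnNge (ltnW k_gt1).
    rewrite inE [v \in C]inE vY andbT; case vB: (v \in B) => //=.
    by apply: contraTT kv => nW; rewrite -ltnNge; apply: T'W; rewrite inE nW.
  have [->|] := eqVneq T set0; first by rewrite cards0.
  case/set0Pn => x xT; have xX := subsetP TX _ xT; have := deg_X_ge xX.
  have ex : e x B <= k.
    move: xT; rewrite inE => /orP[|/(subsetP T'k)]; rewrite inE => /andP[_].
      exact: ltnW.
    by move/eqP->.
  have : e x Y <= e x B + #|C|.
    apply: leq_trans (_ : #|nbh_in G B x :|: C| <= _).
      apply/subset_leq_card/subsetP => u; rewrite !inE => /andP[-> ->].
      by rewrite !andbT orbN.
    exact: leq_of_leqif (leq_card_setU _ _).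
  by move: ex Tk k_gt1; clear; lia.
(* Deleting [R] from [B] leaves each vertex of [Ak] fewer than [k] neighbours. *)
have le2 : #|Al| + #|Ak| <= #|C| + #|R|.
  have cA : #|Al :|: Ak| = #|Al| + #|Ak|.
    by rewrite cardsU; move: dAlk; rewrite -setI_eq0 => /eqP->; rewrite cards0 subn0.
  have BRY : B :\: R \subset Y by apply: subset_trans (subsetDl _ _) BY.
  rewrite -cA; apply: leq_trans (_ : #|Y :\: (B :\: R)| <= _).
    apply: leq_trans (few_X_with_few_nbh BRY).
    apply/subset_leq_card/subsetP => x; rewrite !inE => /orP[/andP[-> lt]|].
      by apply: leq_ltn_trans lt; apply/nbh_in_subset/subsetDl.
    move=> xA; have [xX ex] := andP xA; rewrite xX /= -(eqP ex).
    have xAk : x \in Ak by rewrite inE.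
    have hit : exists2 u, u \in R & u \in nbh_in G B x.
      have [xT'|xT'] := boolP (x \in T').
        have [h0|/card_gt0P[u]] := posnP (e x R0).
          exists (f x); last exact: fB.
          by rewrite inE orbC imset_f // inE xT' h0.
        rewrite inE => /andP[uR0 xu]; exists u; first by rewrite inE uR0.
        by rewrite inE (subsetP R0B).
      (* As [T'] is maximal, adding [x] brings some [u] outside [W] to [k] neighbours; so [u] is in
         [R0] and adjacent to [x]. *)
      have : ~~ good (x |: T').
        apply/negP => /T'max; rewrite subsetUr => /(_ isT) /setP/(_ x).
        by rewrite !inE eqxx (negPf xT').
      rewrite /good subUset sub1set xAk T'k /= => /forall_inPn[u uBW].
      have -> : Al :|: (x |: T') = T :|: [set x] by rewrite setUCA setUC.
      have xT : x \notin T.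
        by rewrite inE negb_or xT' andbT; apply/negP => /(disjointFr dAlk); rewrite xAk.
      have dTx : [disjoint T & [set x]] by rewrite disjoint_sym disjoints1.
      rewrite nbh_inU // -leqNgt => le; have lt := T'W u uBW; rewrite -/T in lt.
      have gt0 : 0 < e u [set x] by move: le lt; clear; lia.
      have : e u [set x] <= #|[set x]|.
        by apply/subset_leq_card/subsetP => w; rewrite [w \in nbh_in _ _ _]inE => /andP[].
      rewrite cards1 => le1x.
      have /card_gt0P[w] := gt0; rewrite !inE => /andP[/eqP-> ux].
      have uR0 : u \in R0 by rewrite inE uBW; move: le lt le1x; clear; lia.
      exists u; first by rewrite inE uR0.
      by rewrite inE (subsetP R0B) //= adj_sym.
    have [u uR uN] := hit; apply/proper_card/properP; split.
      by apply/subsetP => w; rewrite !inE => /andP[/andP[_ ->] ->].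
    by exists u => //; rewrite inE [u \in B :\: R]inE uR.
  have := cardsID B Y; rewrite (setIidPr BY) -/C.
  have := cardsID (B :\: R) Y; rewrite (setIidPr BRY).
  by have := cardsID R B; rewrite (setIidPr RB); clear; lia.
have le3 : #|R| <= #|R0| + #|Tu|.
  apply: leq_trans (leq_of_leqif (leq_card_setU _ _)) _.
  by rewrite leq_add2l leq_imset_card.
have TuT : Tu \subset T' by apply/subsetP => x; rewrite inE => /andP[].
have sumk A : A \subset Ak -> \sum_(x in A) e x B = k * #|A|.
  move=> /subsetP AAk; rewrite (eq_bigr (fun=> k)) ?sum_nat_const 1?mulnC // => x /AAk.
  by rewrite inE => /andP[_ /eqP].
(* The edges between [B] and [T1] are counted twice: a vertex of [W] has at least [k] neighbours in
   [Al], and one of [R0] keeps its [k - 1 >= 1] neighbours, none of which is in [Tu]. *)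
have le4 : k * #|W| + #|R0| + #|Tu| <= \sum_(x in Al) e x B + k * #|T'|.
  pose T1 := Al :|: (T' :\: Tu).
  have dT1 : [disjoint Al & T' :\: Tu] by apply: disjointWr dT; apply: subsetDl.
  have E1 : \sum_(x in Al) e x B + k * #|T' :\: Tu| = \sum_(y in B) e y T1.
    rewrite -sumk; last by apply: subset_trans (subsetDl _ _) T'k.
    rewrite (double_count G Al) (double_count G (T' :\: Tu)) -big_split /=; apply: eq_bigr => y _.
    by rewrite nbh_inU.
  have cT' := cardsID Tu T'; rewrite (setIidPr TuT) in cT'.
  have WB : W \subset B by apply/subsetP => y; rewrite inE => /andP[].
  have dWR : [disjoint W & R0].
    rewrite -setI_eq0; apply/eqP/setP => y; rewrite [LHS]inE [y \in R0]inE [y \in B :\: W]inE.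
    by rewrite [RHS]inE; case: (y \in W).
  have : k * #|W| + #|R0| <= \sum_(y in B) e y T1.
    apply: leq_trans (_ : \sum_(y in W :|: R0) e y T1 <= _); last first.
      rewrite [leqRHS](big_setID (W :|: R0)) /=.
      have -> : B :&: (W :|: R0) = W :|: R0 by apply/setIidPr; rewrite subUset WB.
      exact: leq_addr.
    have -> : \sum_(y in W :|: R0) e y T1 = \sum_(y in W) e y T1 + \sum_(y in R0) e y T1.
      by rewrite -bigU //; apply: eq_bigl => y; rewrite !inE.
    rewrite mulnC -sum_nat_const -sum1_card leq_add //.
      apply: leq_sum => y; rewrite inE => /andP[_ le].
      by apply: leq_trans le _; apply/nbh_in_subset/subsetUl.
    apply: leq_sum => y yR0; have := yR0; rewrite inE => /andP[_ /eqP eT].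
    apply: leq_trans (_ : e y T <= _); first by rewrite eT; move: k_gt1; clear; lia.
    apply/subset_leq_card/subsetP => x; rewrite !inE => /andP[xT yx].
    rewrite yx andbT; case/orP: xT => [->//|xT']; rewrite xT' /= andbT.
    apply/orP; right; apply/negP => /eqP/eqP; rewrite cards_eq0 => /eqP/setP/(_ y).
    by rewrite [y \in nbh_in _ _ _]inE yR0 adj_sym yx inE.
  by rewrite -E1 -cT'; move: k_gt1; clear; nia.
have -> : \sum_(x in X) (k.+1 - e x B) = \sum_(x in Al) (k.+1 - e x B) + #|Ak|.
  have -> : #|Ak| = \sum_(x in Ak) (k.+1 - e x B).
    rewrite -sum1_card; apply: eq_bigr => x; rewrite inE => /andP[_ /eqP->].
    by rewrite subSnn.
  rewrite -bigU //= (bigID [pred x | e x B <= k]) /= [X in _ + X]big1 ?addn0.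
    apply: eq_bigl => x; rewrite !inE leq_eqVlt orbC.
    by case: (x \in X); case: (e x B < k).
  by move=> x /andP[_]; rewrite -ltnNge; clear; lia.
have : \sum_(x in Al) (k.+1 - e x B) + \sum_(x in Al) e x B = k.+1 * #|Al|.
  rewrite -big_split mulnC -sum_nat_const; apply: eq_bigr => x.
  by rewrite inE => /andP[_ lt] /=; move: lt; clear; lia.
(* The sum of [le2], [le3], [le4] and [k] times [le1]. *)
by move: le1 le2 le3 le4; clear; nia.
Qed.

End Split.

(** * Closed sets, and a numerical form of the Erdos-Gallai condition *)

Lemma reach_sub (V : finType) (G : sgraph V) (X : {set V}) F (U Z : {set V}) :
  U \subset Z -> step_closed G X F Z -> reach G X F U \subset Z.
Proof.
move=> /subsetP UZ cZ; apply/subsetP => y; rewrite inE => /exists_inP[y0 /UZ].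
move=> y0Z /connectP[p + ->]; elim: p y0 y0Z => //= y1 p IH y0 y0Z /andP[st].
by apply: IH; apply: cZ st.
Qed.

(** Let [m = #|D|], let [E] be the set of [v] outside [D] with [r v > m], and [b = #|D :|: E|]. The
    claim says that the sums of [r] over [D] and [D :|: E] together are at most [m * b.-1] plus the
    total of [r]; [a] counts the terms from [U], bounded by [t] instead of [q]. *)
Lemma degree_condition (V : finType) (r : V -> nat) (U : {set V}) q t :
  q <= t -> (forall v, r v <= t) -> (forall v, v \notin U -> r v <= q) ->
  (forall m b a, 0 < m <= b -> b <= t -> a <= #|U|.*2 ->
     (m + b) * q + a * (t - q) <= m * b.-1 + \sum_v r v) ->
  forall D : {set V},
    \sum_(v in D) r v <= #|D| * #|D|.-1 + \sum_(v in ~: D) minn (r v) #|D|.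
Proof.
move=> qt rt rq num D.
have [->|D0] := eqVneq D set0; first by rewrite big_set0.
set m := #|D|; have m0 : 0 < m by rewrite card_gt0.
pose E := [set v in ~: D | m < r v].
have ED : E \subset ~: D by apply/subsetP => v; rewrite inE => /andP[].
have dDE : [disjoint D & E] by rewrite disjoint_sym -(setCK D) -disjoints_subset in ED *.
have cB : #|D :|: E| = m + #|E|.
  by rewrite cardsU; move: dDE; rewrite -setI_eq0 => /eqP->; rewrite cards0 subn0.
have sumU (A : {set V}) : \sum_(v in A) r v <= #|A| * q + #|A :&: U| * (t - q).
  rewrite -!sum_nat_const [X in _ <= _ + X](eq_bigl (fun v => (v \in A) && (v \in U))).
    rewrite [X in _ <= _ + X]big_mkcondr -big_split /=; apply: leq_sum => v vA.
    by case: ifP => [_|/negbT /rq]; [have := rt v; lia|rewrite addn0].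
  by move=> v; rewrite inE.
have -> : \sum_(v in ~: D) minn (r v) m = m * #|E| + \sum_(v in ~: (D :|: E)) r v.
  rewrite (big_setID E) /= (setIidPr ED); congr (_ + _).
    rewrite mulnC -sum_nat_const; apply: eq_bigr => v; rewrite inE => /andP[_ lt].
    by apply/minn_idPr/ltnW.
  rewrite setCU -setDE; apply: eq_bigr => v.
  by rewrite !inE => /andP[+ nD]; rewrite nD -leqNgt => le; apply/minn_idPl.
have [le|lt] := leqP #|D :|: E| t; last first.
  have : \sum_(v in D) r v <= m * t.
    by rewrite -sum_nat_const; apply: leq_sum => v _.
  by move: lt m0; rewrite cB; clear; nia.
have := num m #|D :|: E| (#|D :&: U| + #|(D :|: E) :&: U|).
have subU (A : {set V}) : #|A :&: U| <= #|U| by apply/subset_leq_card/subsetIr.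
rewrite m0 {1}cB leq_addr -addnn leq_add // => /(_ isT le isT).
have := sumU D; have := sumU (D :|: E); rewrite -/m.
have -> : \sum_v r v = \sum_(v in D :|: E) r v + \sum_(v in ~: (D :|: E)) r v.
  by rewrite (bigID (mem (D :|: E))) /=; congr (_ + _); apply: eq_bigl => v; rewrite !inE.
have -> : m * #|D :|: E|.-1 = m * m.-1 + m * #|E| by rewrite cB; move: m0; clear; nia.
by clear; nia.
Qed.

(** * Loads of a balanced selection in a split graph *)

Section SplitFactor.
Variables (V : finType) (G : sgraph V) (X Y : {set V}) (k : nat).
Hypothesis k_gt1 : 1 < k.
Hypothesis XY_split : split_partition G X Y.
Hypothesis k_leV : k <= #|V|.
Hypothesis Lambda_ge : forall S : {set V}, k <= #|S| -> #|S| <= #|Lambda G k S|.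
Implicit Types (A B C T Z : {set V}) (u v w x y : V).
Variable F : {ffun V -> {set V}}.
Hypothesis F_bal : balanced G X k.+1 F.

Local Notation e x B := #|nbh_in G B x|.
Local Notation load := (load X F).

Let F_sel : selection G X k.+1 F := F_bal.1.
Let F_adj x u : x \in X -> u \in F x -> G x u.
Proof.
by move=> xX uF; have [/subsetP/(_ u uF)] := selectionP _ _ _ _ F_sel x xX; rewrite inE.
Qed.
Let F_card x : x \in X -> #|F x| = k.+1.
Proof. by move=> xX; have [] := selectionP _ _ _ _ F_sel x xX. Qed.
Let F_Y x u : x \in X -> u \in F x -> u \in Y.
Proof. by move=> xX /(F_adj xX); apply: adj_X_Y XY_split _ _ xX. Qed.

Definition unloaded := [set y in Y | load y == 0].

Lemma load_gt0 x y : x \in X -> y \in F x -> 0 < load y.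
Proof. by move=> xX yF; apply/card_gt0P; exists x; rewrite inE xX. Qed.

Lemma load_le y : load y <= k.+1.
Proof.
apply: balanced_upper F_bal _ => B.
have := hall_condition k_gt1 XY_split k_leV Lambda_ge (subsetIr B Y).
rewrite (eq_bigr (fun x => k.+1 - e x B)) => [le|x xX].
  apply: leq_trans le _; rewrite leq_mul2l; apply/orP; right.
  by apply/subset_leq_card/subsetP => v; rewrite !inE; case: (v \in Y); rewrite ?andbT ?andbF.
congr (_ - _); apply: eq_card => u; rewrite !inE.
by case xu: (G x u); rewrite ?andbF // (adj_X_Y XY_split xX xu) !andbT.
Qed.

Lemma sum_load_Y : \sum_(y in Y) load y = k.+1 * #|X|.
Proof.
rewrite sum_load mulnC -sum_nat_const; apply: eq_bigr => x xX.
have /setIidPl -> : F x \subset Y by apply/subsetP => u; apply: F_Y.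
exact: F_card.
Qed.

Let ex_set_through y : X != set0 -> y \in Y ->
  exists B, [/\ B \subset Y, #|B| = k.-1 & y \in B].
Proof.
move=> X0 yY.
have [B sB cB] : exists2 B : {set V}, B \subset Y :\ y & #|B| = k.-2.
  apply: ex_subset_card; have := cardsD1 y Y; rewrite yY.
  have := card_Y_ge k_gt1 XY_split k_leV Lambda_ge; move: X0; rewrite -card_gt0.
  by clear; lia.
exists (y |: B); rewrite !inE eqxx subUset sub1set yY (subset_trans sB (subsetDl _ _)).
split=> //; rewrite cardsU1 cB; case yB: (y \in B); last by move: k_gt1; clear; lia.
by have := subsetP sB _ yB; rewrite !inE eqxx.
Qed.

(* If there are too many unloaded vertices, then the set [Z] reachable from
   them, on which all loads are at most 1, contradicts [neighbourhood_growth]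
   for the set [P] of those [x] that select a vertex outside [Z]. *)
Lemma unloaded_isolated : X != set0 -> #|Y| <= #|X| + k.-1 + #|unloaded| ->
  #|Y| = #|X| + k.-1 + #|unloaded| /\ {in unloaded, forall y, e y X = 0}.
Proof.
move=> X0 leY; set U := unloaded in leY *; pose Z := reach G X F U.
have X1 : 0 < #|X| by rewrite card_gt0.
have UZ : U \subset Z by apply: sub_reach.
have cZ : step_closed G X F Z by apply: reach_closed.
have ZY : Z \subset Y.
  apply: reach_sub; first by apply/subsetP => y; rewrite inE => /andP[].
  by move=> y' y _ /exists_inP[x xX /and3P[_ _ yF]]; apply: F_Y yF.
have Z1 y : y \in Z -> load y <= 1.
  by apply: balanced_reach F_bal _ => y0; rewrite inE => /andP[_ /eqP->].
have cYZ := cardsID Z Y; rewrite (setIidPr ZY) in cYZ.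
(* Loads on [Z] are 0 or 1, and 0 exactly on [U]. *)
have cUZ : #|Z| = #|U| + \sum_(y in Z) load y.
  rewrite -sum1_card (bigID (mem U)) /=; congr (_ + _).
    rewrite -sum1_card; apply: eq_bigl => y.
    by rewrite andbC; case yU: (y \in U); rewrite //= (subsetP UZ).
  rewrite [RHS](bigID (mem U)) /= [X in _ = X + _]big1 ?add0n; last first.
    by move=> y /andP[_]; rewrite inE => /andP[_ /eqP].
  apply: eq_bigr => y /andP[yZ]; rewrite inE (subsetP ZY) //=.
  by move: (Z1 y yZ); case: (load y) => [|[|]].
rewrite sum_load in cUZ.
pose Q := [set x in X | F x \subset Z]; pose P := X :\: Q.
have PX : P \subset X by apply: subsetDl.
have QX : Q \subset X by apply/subsetP => x; rewrite inE => /andP[].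
have cXQ := cardsID Q X; rewrite (setIidPr QX) -/P in cXQ.
have sumQ : \sum_(x in Q) #|F x :&: Z| = k.+1 * #|Q|.
  rewrite mulnC -sum_nat_const; apply: eq_bigr => x; rewrite inE => /andP[xX /setIidPl->].
  exact: F_card.
rewrite (big_setID Q) /= (setIidPr QX) -/P sumQ in cUZ.
have [P0|P0] := eqVneq P set0.
  move: cUZ cYZ cXQ; rewrite P0 big_set0 cards0; move: leY X1 k_gt1; clear; nia.
(* Otherwise a step from [y] leads to each vertex of [F x], which puts [x] into [Q]. *)
have PF x y : x \in P -> y \in Z -> G x y -> y \in F x.
  case/setDP => xX; rewrite inE xX /= => nQ yZ xy.
  apply: contraNT nQ => nF; apply/subsetP => w wF; apply: cZ yZ _.
  by apply/exists_inP; exists x => //; rewrite xy nF wF.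
have eP y : y \in Z -> e y P <= load y.
  move=> yZ; apply/subset_leq_card/subsetP => x.
  rewrite [x \in nbh_in _ _ _]inE => /andP[xP yx]; rewrite inE (subsetP PX) //=.
  by apply: PF; rewrite // adj_sym.
(* Each vertex of [O1] has exactly one neighbour in [P], so [#|O1|] is the load that [P] puts on
   [Z]. *)
pose O1 := [set y in Z | 0 < e y P].
have cO1 : \sum_(x in P) #|F x :&: Z| = #|O1|.
  rewrite (eq_bigr (fun x => e x Z)) => [|x xP].
    rewrite double_count -sum1_card [RHS](eq_bigl (fun y => (y \in Z) && (0 < e y P))).
      rewrite [RHS]big_mkcondr /=; apply: eq_bigr => y yZ.
      by have := leq_trans (eP y yZ) (Z1 y yZ); case: (e y P) => [|[|]].
    by move=> y; rewrite inE.
  apply: eq_card => y; rewrite inE [RHS]inE andbC; case yZ: (y \in Z) => //=.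
  by apply/idP/idP; [apply: F_adj (subsetP PX _ xP)|apply: PF].
rewrite cO1 in cUZ.
(* A vertex of [O1 :&: B] would need two neighbours in [P] to count in [neighbourhood_growth]. *)
have key B : B \subset Y -> #|B| = k.-1 ->
    #|U| + k * #|Q| + #|O1 :&: B| + #|X| + k.-1 <= #|Y|.
  move=> BY cB.
  have := neighbourhood_growth k_gt1 XY_split k_leV Lambda_ge PX P0 BY cB.
  have : #|[set y in Y | (y \in B) < e y P]| <= #|Y :\: Z| + #|O1 :\: B|.
    apply: leq_trans (leq_of_leqif (leq_card_setU _ _)).
    apply/subset_leq_card/subsetP => y; rewrite [_ \in [set _ in _ | _]]inE => /andP[yY lt].
    rewrite inE [y \in Y :\: Z]inE yY andbT [y \in O1 :\: B]inE [y \in O1]inE.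
    case yZ: (y \in Z) => //=; have := leq_trans (eP y yZ) (Z1 y yZ).
    by move: lt; clear; case: (y \in B); lia.
  have := cardsID B O1; move: cYZ cXQ cUZ; clear; nia.
(* For [B] through a vertex of [O1], [key] contradicts [leY]; so [O1] is empty, and [key] then
   forces [Q] to be empty. *)
have {}leY : #|Y| = #|X| + k.-1 + #|U| /\ #|Q| = 0 /\ O1 = set0.
  have [O0|] := eqVneq O1 set0.
    have [x xX] := set0Pn _ X0.
    have [y yF] : exists y, y \in F x by apply/card_gt0P; rewrite F_card.
    have [B [BY cB _]] := ex_set_through X0 (F_Y xX yF).
    have le := key B BY cB.
    by split; [|split=> //]; move: le leY k_gt1; clear; nia.
  case/set0Pn => y yO.
  have yY : y \in Y by move: yO; rewrite inE => /andP[/(subsetP ZY)].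
  have [B [BY cB yB]] := ex_set_through X0 yY.
  have : 0 < #|O1 :&: B| by apply/card_gt0P; exists y; rewrite inE yO.
  by have := key B BY cB; move: leY; clear; lia.
have [? [Q0 O0]] := leY; split=> // y yU.
have PE : P = X by rewrite /P (cards0_eq Q0) setD0.
have /setP/(_ y) := O0; rewrite inE (subsetP UZ) // PE in_set0 /=.
by case: (e y X).
Qed.

(** If [load y1 <= 1], the loads on the set [Z] reachable from [y1] are at most 2 and add up to less
    than [2 #|Z|]. For [#|Z| <= k + 1] this fails because each vertex of [Z] has at least two
    neighbours in [X]; for larger [Z] it contradicts [hall_condition] for [Z :|: U]. *)
Lemma load_ge2 : X != set0 -> #|Y| = #|X| + k.-1 + #|unloaded| ->
  {in unloaded, forall y, e y X = 0} ->
  forall y, y \in Y -> y \notin unloaded -> 1 < load y.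
Proof.
move=> X0; set U := unloaded => cY U0 y1 y1Y y1U; rewrite ltnNge; apply/negP => le1.
have UY : U \subset Y by apply/subsetP => y; rewrite inE => /andP[].
have cYU := cardsID U Y; rewrite (setIidPr UY) in cYU.
pose Z := reach G X F [set y1].
have y1Z : y1 \in Z by apply: (subsetP (sub_reach _ _ _ _)); rewrite inE.
have cZ : step_closed G X F Z by apply: reach_closed.
have ZY : Z \subset Y :\: U.
  apply: reach_sub; first by rewrite sub1set inE y1U.
  move=> y' y _ /exists_inP[x xX /and3P[_ _ yF]].
  by rewrite !inE (F_Y xX yF) (gtn_eqF (load_gt0 xX yF)).
have Z2 y : y \in Z -> load y <= 2.
  by apply: balanced_reach F_bal _ => y0; rewrite inE => /eqP->.
have sumZ : \sum_(y in Z) load y < #|Z| * 2.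
  rewrite -sum_nat_const (bigD1 y1) // [X in _ < X](bigD1 y1) //= -addSn leq_add //.
  by apply: leq_sum => y /andP[/Z2].
have := sumZ; apply/negP; rewrite -leqNgt (sum_load_closed F_sel cZ).
have [leZ|gtZ] := leqP #|Z| k.+1.
  rewrite (eq_bigr (fun x => e x Z)) => [|x _]; last first.
    apply/minn_idPr; apply: leq_trans leZ; apply/subset_leq_card/subsetP => u.
    by rewrite inE => /andP[].
  rewrite double_count -sum_nat_const; apply: leq_sum => y /(subsetP ZY).
  rewrite inE => /andP[yU yY]; have [B [BY cB yB]] := ex_set_through X0 yY.
  (* As [Y :\: U] has only [#|X| + k - 1] elements, [N] is all of it; since [y] is in [B], it has
     two neighbours in [X]. *)
  have := neighbourhood_growth k_gt1 XY_split k_leV Lambda_ge (subxx X) X0 BY cB.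
  set N := [set _ in _ | _] => leN.
  have NU : N \subset Y :\: U.
    apply/subsetP => w; rewrite !inE => /andP[wY lt]; rewrite wY andbT.
    apply: contraTN lt => w0; rewrite U0 ?ltn0 //.
    by rewrite inE wY.
  have : y \in N.
    have /eqP -> : N == Y :\: U by rewrite eqEcard NU; move: leN cY cYU; clear; lia.
    by rewrite inE yU.
  by rewrite inE yB => /andP[].
have ZUY : Z :|: U \subset Y by rewrite subUset UY (subset_trans ZY) ?subsetDl.
have dZU : [disjoint Z & U].
  by rewrite disjoints_subset; apply: subset_trans ZY _; rewrite setDE subsetIr.
have := hall_condition k_gt1 XY_split k_leV Lambda_ge ZUY.
rewrite (eq_bigr (fun x => k.+1 - e x Z)) => [|x xX]; last first.
  rewrite nbh_inU //; have -> : e x U = 0; last by rewrite addn0.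
  apply: eq_card0 => u; rewrite [LHS]inE; apply/negP => /andP[uU xu].
  have := U0 u uU => /eqP; rewrite cards_eq0 => /eqP/setP/(_ x).
  by rewrite !inE xX adj_sym xu.
have := cardsID (Z :|: U) Y; rewrite (setIidPr ZUY).
have -> : #|Z :|: U| = #|Z| + #|U|.
  by rewrite cardsU; move: dZU; rewrite -setI_eq0 => /eqP->; rewrite cards0 subn0.
have : \sum_(x in X) minn k.+1 (e x Z) + \sum_(x in X) (k.+1 - e x Z) = k.+1 * #|X|.
  by rewrite -big_split mulnC -sum_nat_const; apply: eq_bigr => x _ /=; clear; lia.
by move: gtZ cY k_gt1; clear; nia.
Qed.

End SplitFactor.

(** * Inequalities required by [degree_condition] *)

Lemma large_excess_bound k z m b : 0 < m <= b -> b <= k.+1 -> 1 < k -> 3 <= z ->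
  (m + b) * k.+1 <= m * b.-1 + k.+1 * (k.-1 + z).
Proof.
move=> /andP[m0 mb] bk k1 z3.
have E : m * k.+1 = m * b.-1 + m * (k.+2 - b).
  by rewrite -mulnDr; congr (_ * _); lia.
rewrite mulnDl E -addnA leq_add2l.
(* Replacing [m] by [k + 1] makes the left side [(k+1)(k+2)], hence the bound 3 on [z]. *)
apply: leq_trans (_ : k.+1 * (k.+2 - b) + b * k.+1 <= _).
  by rewrite leq_add2r leq_mul2r; lia.
by rewrite [b * _]mulnC -mulnDr leq_mul2l; lia.
Qed.

(** For [q = k] and [#|U| < z]. Replacing [m] by [b] leaves [b(k+1-b) + bk <= k(k+1)], and [a] is
    absorbed by [(k+1)(z-1)]. *)
Lemma few_unloaded_bound k z m b a : 0 < m <= b -> b <= k.+1 -> 1 < k -> 0 < z ->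
  a <= z.-1.*2 -> (m + b) * k + a <= m * b.-1 + k.+1 * (k.-1 + z).
Proof.
move=> /andP[m0 mb] bk k1 z0 az.
have E : m * k = m * b.-1 + m * (k.+1 - b).
  by rewrite -mulnDr; congr (_ * _); lia.
have -> : k.-1 + z = k + z.-1 by lia.
rewrite mulnDl E -!addnA leq_add2l mulnDr addnA leq_add //; last first.
  by apply: leq_trans az _; rewrite -mul2n leq_mul2r; lia.
apply: leq_trans (_ : b * (k.+1 - b) + b * k <= _); first by rewrite leq_add2r leq_mul2r mb orbT.
have [j bj] : exists j, k.+1 = b + j by exists (k.+1 - b); lia.
have -> : k.+1 - b = j by lia.
have le : j <= j * j by case: (j) => // i; rewrite leq_pmull.
by move: bj le; clear; nia.
Qed.

(** For [q = k - 1] and [#|U| = z]. If [k = 2] and [z = 1], then [4z] exceeds [(k+1)z] by one; this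
    unit is gained from [m > 0] if [b = k + 1], and from [k > 1] otherwise. *)
Lemma isolated_unloaded_bound k z m b a : 0 < m <= b -> b <= k.+1 -> 1 < k ->
  a <= z.*2 -> (3 <= k) || (z <= 1) ->
  (m + b) * k.-1 + a * 2 <= m * b.-1 + k.+1 * (k.-1 + z).
Proof.
move=> /andP[m0 mb] bk k1 az kz.
have az' : a * 2 <= k.+1 * z + 1.
  apply: leq_trans (_ : 4 * z <= _); first lia.
  case/orP: kz => [k3|]; last by case: z {az} => [|[|]] //; lia.
  by apply: leq_trans (leq_addr _ _); rewrite leq_mul2r; lia.
case: k k1 bk {kz} az' => [|k] //= k1 bk az'.
have [->|bk'] := eqVneq b k.+2; first by move: m0 az'; clear; nia.
have E : m * k = m * b.-1 + m * (k.+1 - b).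
  by rewrite -mulnDr; congr (_ * _); lia.
rewrite mulnDl E -!addnA leq_add2l mulnDr addnA.
apply: leq_trans (_ : b * (k.+1 - b) + b * k + a * 2 <= _).
  by rewrite !leq_add2r leq_mul2r mb orbT.
have [j bj] : exists j, k.+1 = b + j by exists (k.+1 - b); lia.
have -> : k.+1 - b = j by lia.
have le : j <= j * j by case: (j) => // i; rewrite leq_pmull.
by move: bj le az' k1; move: (k.+2 * z) => w; clear; nia.
Qed.

(** * Assembling the factor from [F] and [R] *)

Section Factor.
Variables (V : finType) (G : sgraph V) (X Y : {set V}) (t : nat).
Hypothesis XY_split : split_partition G X Y.
Variables (F : {ffun V -> {set V}}) (R : sgraph V).
Hypothesis F_sel : selection G X t F.
Hypothesis R_X : forall x, x \in X -> deg R x = 0.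
Hypothesis R_Y : forall y, y \in Y -> deg R y + load X F y = t.

Let R_subY u v : R u v -> u \in Y.
Proof.
move=> uv; rewrite (in_Y XY_split); apply/negP => /R_X/eqP; rewrite cards_eq0.
by move=> /eqP/setP/(_ v); rewrite !inE uv.
Qed.

Definition joined u v :=
  [|| R u v, (u \in X) && (v \in F u) | (v \in X) && (u \in F v)].

Fact joined_sym : symmetric joined.
Proof. by move=> u v; rewrite /joined adj_sym [X in _ || X]orbC. Qed.

Let F_adj x u : x \in X -> u \in F x -> G x u.
Proof.
by move=> xX uF; have [/subsetP/(_ u uF)] := selectionP _ _ _ _ F_sel x xX; rewrite inE.
Qed.

Fact joined_irrefl : irreflexive joined.
Proof.
move=> u; rewrite /joined adj_irrefl orbb /=; apply/negP => /andP[uX /(F_adj uX)].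
by rewrite adj_irrefl.
Qed.

Lemma joined_factor : is_factor G t (SGraph joined_sym joined_irrefl).
Proof.
have [_ _ _ cl] := XY_split; split=> [u v /=|v].
  case/or3P => [uv|/andP[uX /(F_adj uX)//]|/andP[vX /(F_adj vX)]]; last by rewrite adj_sym.
  have vY : v \in Y by apply: (@R_subY v u); rewrite adj_sym.
  apply: cl (R_subY uv) vY _; apply: contraTneq uv => ->.
  by rewrite adj_irrefl.
have [vX|vX] := boolP (v \in X).
  have [_ <-] := selectionP _ _ _ _ F_sel v vX; apply: eq_card => u.
  rewrite !inE /= /joined vX /=; have -> : R v u = false.
    by apply/negP => /R_subY; rewrite (in_Y XY_split) vX.
  case vF: (v \in F u); rewrite ?andbF ?orbF //=; apply/orb_idr; rewrite andbT => uX.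
  by have := adj_X_Y XY_split uX (F_adj uX vF); rewrite (in_Y XY_split) vX.
have vY : v \in Y by rewrite (in_Y XY_split).
(* Edges of [R] stay inside [Y], so the two neighbourhoods of [v] are disjoint. *)
rewrite -(R_Y vY) /deg /load -cardsUI [X in _ = _ + X](_ : _ = 0) ?addn0.
  by apply: eq_card => u; rewrite !inE /= /joined (negPf vX).
apply: eq_card0 => u; rewrite !inE; apply/negP => /and3P[vu uX _].
by have := @R_subY u v; rewrite adj_sym (in_Y XY_split) uX => /(_ vu).
Qed.

End Factor.

Lemma split_factor (V : finType) (G : sgraph V) (X Y : {set V}) k :
  1 < k -> split_partition G X Y -> ~~ odd (#|X| + #|Y|) -> k <= #|V| ->
  (forall S : {set V}, k <= #|S| -> #|S| <= #|Lambda G k S|) ->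
  exists H : sgraph V, is_factor G k.+1 H.
Proof.
move=> k_gt1 XY_split XY_even k_leV Lambda_ge.
have [F bF] : exists F, balanced G X k.+1 F.
  apply: ex_balanced => x xX; rewrite (deg_X XY_split xX).
  have := deg_X_ge k_gt1 XY_split k_leV Lambda_ge xX; move: k_gt1; clear; lia.
have ld y : load X F y <= k.+1 := load_le k_gt1 XY_split k_leV Lambda_ge bF y.
pose r v := if v \in Y then k.+1 - load X F v else 0.
have leXY := card_Y_ge k_gt1 XY_split k_leV Lambda_ge.
pose z := #|Y| - (#|X| + k.-1).
have cY : #|Y| = #|X| + k.-1 + z by rewrite /z subnKC.
have sum_r : \sum_v r v = k.+1 * (k.-1 + z).
  have : \sum_(v in Y) r v + \sum_(v in Y) load X F v = k.+1 * #|Y|.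
    rewrite -big_split mulnC -sum_nat_const; apply: eq_bigr => y yY.
    by rewrite /r yY /= subnK.
  have -> : \sum_v r v = \sum_(v in Y) r v.
    by rewrite [RHS]big_mkcond; apply: eq_bigr => v _; rewrite /r; case: ifP.
  by rewrite (sum_load_Y XY_split bF) cY; clear; nia.
have r_le v : r v <= k.+1 by rewrite /r; case: ifP => // _; apply: leq_subr.
have kz_even : ~~ odd (k.-1 + z).
  by move: XY_even; rewrite cY !addnA addnn -addnA oddD odd_double.
have r_even : ~~ odd (\sum_v r v) by rewrite sum_r oddM (negPf kz_even) andbF.
pose U := unloaded X Y F.
(* Three cases: [z >= 3]; fewer than [z] unloaded vertices; exactly [z], all other loads on [Y]
   being at least 2. They use [q = k + 1], [k] and [k - 1]. *)
have EG : forall D : {set V},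
    \sum_(v in D) r v <= #|D| * #|D|.-1 + \sum_(v in ~: D) minn (r v) #|D|.
  have [z3|z2] := leqP 3 z.
    apply: (@degree_condition _ r set0 k.+1 k.+1) => // m b a /andP[m0 mb] bk _.
    by rewrite subnn muln0 addn0 sum_r large_excess_bound // m0.
  (* For empty [X], [#|Y| >= 2k] gives [z >= k + 1 >= 3]. *)
  have X0 : X != set0.
    apply: contraTneq z2 => X0; have := card_Y_ge_X0 k_gt1 XY_split k_leV Lambda_ge X0.
    by rewrite -leqNgt; move: cY k_gt1; rewrite X0 cards0; clear; lia.
  have rU v : v \notin U -> r v <= k.
    rewrite inE /r; case: ifP => //= _; move: (ld v); clear; lia.
  have [zU|Uz] := leqP z #|U|; last first.
    apply: (@degree_condition _ r U k k.+1) => // m b a /andP[m0 mb] bk aU.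
    rewrite subSnn muln1 sum_r few_unloaded_bound ?m0 //; first exact: leq_ltn_trans Uz.
    by apply: leq_trans aU _; rewrite leq_double; move: Uz; clear; lia.
  have leY : #|Y| <= #|X| + k.-1 + #|U| by rewrite cY leq_add2l.
  have [cYU U0] := unloaded_isolated k_gt1 XY_split k_leV Lambda_ge bF X0 leY.
  have Uz : #|U| = z by move: cYU; rewrite cY => /addnI.
  apply: (@degree_condition _ r U k.-1 k.+1) => // [|v vU|m b a].
  - by move: k_gt1; clear; lia.
  - rewrite /r; case: ifP => // vY.
    have := load_ge2 k_gt1 XY_split k_leV Lambda_ge bF X0 cYU U0 vY vU.
    by clear; lia.
  rewrite Uz sum_r => mb bk az.
  have -> : k.+1 - k.-1 = 2 by move: k_gt1; clear; lia.
  (* For [k = 2], parity excludes [z = 2], which the bound does not cover. *)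
  apply: isolated_unloaded_bound => //; case: leqP => //= k2.
  have k2' : k = 2 by move: k2 k_gt1; clear; lia.
  by move: z2 kz_even; rewrite k2'; case: (z) => [|[|[|]]].
have [R dR] := erdos_gallai r_even EG.
have R_X x : x \in X -> deg R x = 0.
  by move=> xX; rewrite dR /r (in_Y XY_split) xX.
have R_Y y : y \in Y -> deg R y + load X F y = k.+1.
  by move=> yY; rewrite dR /r yY subnK.
by eexists; apply: (joined_factor XY_split bF.1 R_X R_Y).
Qed.

Local Open Scope ring_scope.

Theorem theorem1p2 (k : nat) (hk : (2 <= k)%N) (V : finType) (G : sgraph V)
    (X Y : {set V}) (hXY : split_partition G X Y)
    (heven : ~~ odd (#|X| + #|Y|)%N) (hbeta : 1 <= beta G k) :
  exists H : sgraph V, is_factor G k.+1 H.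
Proof.
(* For [#|V| < k] the value [0] of [beta] contradicts [hbeta]. *)
have k_leV : (k <= #|V|)%N.
  by rewrite leqNgt; apply: contraTN hbeta => lt; rewrite /beta lt.
apply: (split_factor hk hXY heven k_leV) => S kS.
(* If [Lambda G k S] is everything, [S] is not admissible, but the bound is trivial. *)
have [->|nT] := eqVneq (Lambda G k S) setT; first by rewrite cardsT max_card.
have k0V : (0 < k <= #|V|)%N by rewrite (ltnW hk).
have [_ /(_ S)] := beta_min G k0V; rewrite /beta_admissible kS nT => /(_ isT).
move=> /(Order.POrderTheory.le_trans hbeta); rewrite /beta_ratio.
rewrite Num.Theory.ler_pdivlMr ?GRing.mul1r ?Num.Theory.ler_nat //.
by rewrite Num.Theory.ltr0n; apply: leq_trans kS; apply: ltnW.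
Qed.
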